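(* Let $d\ge 1$ and $n\ge 2$ be integers. For each $i\in\{1,\dots,d+1\}$ let $\delta_i\in\mathbb{R}^d$ and let $\vec{\mathbf a}_i$ be an infinite matrix with $d$ rows, infinitely many columns and entries in $\{0,\dots,n-1\}$, and assume that $\delta_1,\dots,\delta_{d+1}$ are separated. Then the collection of $n$-adic grids $\mathcal G(\delta_1,\mathcal L_{\vec{\mathbf a}_1}),\dots,\mathcal G(\delta_{d+1},\mathcal L_{\vec{\mathbf a}_{d+1}})$ in $\mathbb{R}^d$ is adjacent if and only if the following two conditions hold (a hat means that the term is omitted): (i) For each $i\in\{1,\dots,d+1\}$, $\delta_i$ is an $n$-far vector with respect to $\mathfrak L(\delta_1,\dots,\widehat{\delta_i},\dots,\delta_{d+1})$. (ii) For each $i\in\{1,\dots,d+1\}$, writing $\mathcal S_i(j):=\mathcal S^{\delta_1,\dots,\widehat{\delta_i},\dots,\delta_{d+1}}_{\vec{\mathbf a}_1,\dots,\widehat{\vec{\mathbf a}_i},\dots,\vec{\mathbf a}_{d+1}}(j)$, $$0<\liminf_{j\to\infty}\frac{\operatorname{dist}\left((m\mathcal C)^{\delta_i}_{\vec{\mathbf a}_i}(j),\,\mathcal S_i(j)\right)}{n^j}\le\limsup_{j\to\infty}\frac{\max_{y'\in\mathcal S_i(j)}\operatorname{dev}\left((m\mathcal C)^{\delta_i}_{\vec{\mathbf a}_i}(j),\,y'\right)}{n^j}<1.$$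
   Context: Throughout, $\mathbb{N}=\{0,1,2,\dots\}$, and $(v)_s$ denotes the $s$-th component of $v\in\mathbb{R}^d$. Cubes are axis-parallel, and $\ell(Q)>0$ denotes the sidelength of a cube $Q$. An $n$-adic grid in $\mathbb{R}^d$ is a collection $\mathcal G$ of left-closed, right-open cubes $[a_1,a_1+\ell)\times\dots\times[a_d,a_d+\ell)$ such that: (i) every $Q\in\mathcal G$ has sidelength $n^k$ for some $k\in\mathbb{Z}$; (ii) $Q\cap R\in\{Q,R,\emptyset\}$ for all $Q,R\in\mathcal G$; (iii) for each fixed $k\in\mathbb{Z}$, the cubes in $\mathcal G$ of sidelength $n^k$ form a partition of $\mathbb{R}^d$. Location function: for an infinite matrix $\vec{\mathbf a}=\{\vec a_0,\vec a_1,\dots\}$ with columns $\vec a_j\in\{0,\dots,n-1\}^d$ ($j\ge 0$), define $\mathcal L_{\vec{\mathbf a}}:\mathbb{N}\to\mathbb{Z}^d$ by $\mathcal L_{\vec{\mathbf a}}(0)=\vec 0$ and $\mathcal L_{\vec{\mathbf a}}(j)=\sum_{i=0}^{j-1}n^i\vec a_i$ for $j\ge 1$. The grid $\mathcal G(\delta,\mathcal L_{\vec{\mathbf a}})$: for $\delta\in\mathbb{R}^d$ it is the union over $m\in\mathbb{Z}$ of the $m$-th generations $\mathcal G(\delta,\mathcal L_{\vec{\mathbf a}})_m$, consisting of all cubes $$\prod_{s=1}^d\left[(v_m)_s+\frac{k_s}{n^m},\,(v_m)_s+\frac{k_s+1}{n^m}\right),\qquad (k_1,\dots,k_d)\in\mathbb{Z}^d,$$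 where $v_m=\delta$ for $m\ge 0$ and $v_m=\delta+\mathcal L_{\vec{\mathbf a}}(-m)$ for $m<0$. For $m\ge 0$ this does not depend on $\vec{\mathbf a}$ and is also written $\mathcal G(\delta)_m$. For a generation $\mathcal G_m$, $b[\mathcal G_m]$ denotes the union of the (topological) boundaries of all cubes in $\mathcal G_m$. Adjacency: $d+1$ $n$-adic grids $\mathcal G_1,\dots,\mathcal G_{d+1}$ in $\mathbb{R}^d$ are adjacent if there is a constant $C>0$ (independent of $Q$) such that for every cube $Q\subseteq\mathbb{R}^d$ (equivalently, every ball) there exist $i\in\{1,\dots,d+1\}$ and $R\in\mathcal G_i$ with $Q\subseteq R$ and $\ell(R)\le C\,\ell(Q)$. Separated: vectors $\delta_1,\dots,\delta_\ell\in\mathbb{R}^d$ are separated if $(\delta_i)_k\not\equiv(\delta_j)_k \pmod 1$ for all $k\in\{1,\dots,d\}$ and $1\le i\ne j\le\ell$. Small scale lattice: for separated $\eta_1,\dots,\eta_d\in\mathbb{R}^d$ and $m\ge 0$, $\mathfrak L(\eta_1,\dots,\eta_d;m)=\bigcap_{i=1}^d b[\mathcal G(\eta_i)_m]$, and $\mathfrak L(\eta_1,\dots,\eta_d)=\bigcup_{m\ge 0}\mathfrak L(\eta_1,\dots,\eta_d;m)$. $n$-far vector: for separated $\eta_1,\dots,\eta_d$, a vector $\delta\in\mathbb{R}^d$ is $n$-far with respect to $\mathfrak L(\eta_1,\dots,\eta_d)$ if there is $C>0$ such that for every $m\ge 0$, $\operatorname{dist}(b[\mathcal G(\delta)_m],\mathfrak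 L(\eta_1,\dots,\eta_d;m))\ge C/n^m$. Large scale sampling: for separated $\eta_1,\dots,\eta_d\in\mathbb{R}^d$, infinite matrices $\vec{\mathbf b}_1,\dots,\vec{\mathbf b}_d$, each with $d$ rows, infinitely many columns (indexed by $0,1,2,\dots$) and entries in $\{0,\dots,n-1\}$, and $j>0$, $$\mathcal S^{\eta_1,\dots,\eta_d}_{\vec{\mathbf b}_1,\dots,\vec{\mathbf b}_d}(j)=\left(\bigcap_{k=1}^d b[\mathcal G(\eta_k,\mathcal L_{\vec{\mathbf b}_k})_{-j}]\right)\cap[0,n^j)^d,$$ which is a finite set. Modulated corner set: for $j\ge 0$, $(m\mathcal C)^{\delta}_{\vec{\mathbf a}}(j)=b[\mathcal G(\delta,\mathcal L_{\vec{\mathbf a}})_{-j}]\cap[0,n^j)^d$. Distances: $\operatorname{dist}(A,B)=\inf_{x\in A,\,y\in B}\|x-y\|$ (Euclidean norm). For $A\subseteq\mathbb{R}^d$ and $x\in\mathbb{R}^d$, $\operatorname{dev}(A,x)=\max_{1\le k\le d}\operatorname{dist}_{\vec e_k}(A,x)$, where $\operatorname{dist}_{\vec e_k}(A,x)=\inf\{|t|: x+t\vec e_k\in A\}$ is the distance between $x$ and $A$ along the $k$-th standard basis direction $\vec e_k$. *)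

(* Defs.v *)
From mathcomp Require Import all_boot all_order all_algebra.
From mathcomp Require Import all_classical all_reals all_analysis.

Set Implicit Arguments.
Unset Strict Implicit.
Unset Printing Implicit Defensive.

Import Order.TTheory GRing.Theory Num.Theory.
Import numFieldNormedType.Exports.

Local Open Scope classical_set_scope.
Local Open Scope ring_scope.

(* The library norm on row vectors is the sup norm, so the Euclidean norm is
   written out; the library topology on row vectors is the usual one. *)
Definition enorm (R : realType) (d : nat) (x : 'rV[R]_d) : R :=
  Num.sqrt (\sum_(s < d) x 0 s ^+ 2).

(* An infimum in the extended reals: the distance to the empty set is +oo. *)
Definition dist (R : realType) (d : nat) (A B : set 'rV[R]_d) : \bar R :=
  ereal_inf [set (enorm (x - y))%:E | x in A & y in B].

Definition dist_dir (R : realType) (d : nat) (k : 'I_d)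
    (A : set 'rV[R]_d) (x : 'rV[R]_d) : \bar R :=
  ereal_inf [set `|t|%:E | t in [set t : R | A (x + t *: delta_mx 0 k)]].

Definition dev (R : realType) (d : nat) (A : set 'rV[R]_d) (x : 'rV[R]_d) :
    \bar R :=
  \big[maxe/-oo%E]_(k < d) dist_dir k A x.

(* A cube may contain or omit each of its faces: [p s] and [q s] range over the
   four kinds of bounded intervals in direction [s]. *)
Definition is_cube (R : realType) (d : nat) (Q : set 'rV[R]_d) (l : R) : Prop :=
  0 < l /\
  exists (a : 'rV[R]_d) (p q : 'I_d -> bool),
    Q = [set x | forall s,
           x 0 s \in Interval (BSide (p s) (a 0 s)) (BSide (q s) (a 0 s + l))].

Definition hcube (R : realType) (d : nat) (a : 'rV[R]_d) (l : R) :
    set 'rV[R]_d :=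
  [set x | forall s, x 0 s \in `[a 0 s, a 0 s + l[].

Definition nadic_grid (R : realType) (d n : nat) (G : set (set 'rV[R]_d)) :
    Prop :=
  [/\ forall Q, G Q -> exists (a : 'rV[R]_d) (k : int), Q = hcube a (n%:R ^ k),
      forall P Q, G P -> G Q ->
        [\/ P `&` Q = P, P `&` Q = Q | P `&` Q = set0]
    & forall k : int,
        partition [set Q | G Q /\ is_cube Q (n%:R ^ k)] id [set: 'rV[R]_d]].

Definition adjacent_grids (R : realType) (d n : nat)
    (G : 'I_d.+1 -> set (set 'rV[R]_d)) : Prop :=
  (forall i, nadic_grid n (G i)) /\
  exists C : R, 0 < C /\
    forall (Q : set 'rV[R]_d) (l : R), is_cube Q l ->
      exists (i : 'I_d.+1) (P : set 'rV[R]_d) (r : R),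
        [/\ G i P, is_cube P r, Q `<=` P & r <= C * l].

Definition location (d n : nat) (a : nat -> 'I_d -> 'I_n) (j : nat) :
    'rV[int]_d :=
  \row_s \sum_(i < j) (n%:Z ^+ i * (a i s : nat)%:Z).

Definition offset_cubes (R : realType) (d n : nat) (v : 'rV[R]_d) (m : int) :
    set (set 'rV[R]_d) :=
  [set Q | exists k : 'rV[int]_d,
     Q = hcube (\row_s (v 0 s + (k 0 s)%:~R / n%:R ^ m)) ((n%:R ^ m)^-1)].

Definition offset (R : realType) (d : nat) (delta : 'rV[R]_d)
    (L : nat -> 'rV[int]_d) (m : int) : 'rV[R]_d :=
  if 0 <= m then delta else delta + map_mx intr (L `|m|%N).

Definition generation (R : realType) (d n : nat) (delta : 'rV[R]_d)
    (L : nat -> 'rV[int]_d) (m : int) : set (set 'rV[R]_d) :=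
  offset_cubes n (offset delta L m) m.

Definition grid (R : realType) (d n : nat) (delta : 'rV[R]_d)
    (L : nat -> 'rV[int]_d) : set (set 'rV[R]_d) :=
  \bigcup_(m in [set: int]) generation n delta L m.

(* Generations of nonnegative index do not depend on the location function. *)
Definition small_generation (R : realType) (d n : nat) (delta : 'rV[R]_d)
    (m : nat) : set (set 'rV[R]_d) :=
  offset_cubes n delta m%:Z.

Definition boundaries (R : realType) (d : nat) (F : set (set 'rV[R]_d)) :
    set 'rV[R]_d :=
  \bigcup_(Q in F) (closure Q `\` interior Q).

Definition separated_vectors (R : realType) (d l : nat) (delta : 'I_l -> 'rV[R]_d) :
    Prop :=
  forall (k : 'I_d) (i j : 'I_l), i != j ->
    ~ exists z : int, delta i 0 k - delta j 0 k = z%:~R.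

Definition small_scale_lattice (R : realType) (d n : nat)
    (eta : 'I_d -> 'rV[R]_d) (m : nat) : set 'rV[R]_d :=
  \bigcap_(i in [set: 'I_d]) boundaries (small_generation n (eta i) m).

Definition n_far (R : realType) (d n : nat) (delta : 'rV[R]_d)
    (eta : 'I_d -> 'rV[R]_d) : Prop :=
  exists C : R, 0 < C /\
    forall m : nat,
      ((C / n%:R ^+ m)%:E <=
       dist (boundaries (small_generation n delta m))
            (small_scale_lattice n eta m))%E.

Definition big_cube (R : realType) (d n j : nat) : set 'rV[R]_d :=
  hcube 0 (n%:R ^+ j).

Definition large_sampling (R : realType) (d n : nat) (eta : 'I_d -> 'rV[R]_d)
    (b : 'I_d -> nat -> 'I_d -> 'I_n) (j : nat) : set 'rV[R]_d :=
  (\bigcap_(k in [set: 'I_d])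
     boundaries (generation n (eta k) (location (b k)) (- j%:Z)))
  `&` big_cube n j.

Definition corner_set (R : realType) (d n : nat) (delta : 'rV[R]_d)
    (a : nat -> 'I_d -> 'I_n) (j : nat) : set 'rV[R]_d :=
  boundaries (generation n delta (location a) (- j%:Z)) `&` big_cube n j.

Definition omit (T : Type) (d : nat) (f : 'I_d.+1 -> T) (i : 'I_d.+1) :
    'I_d -> T :=
  fun k => f (lift i k).

Definition dist_ratio (R : realType) (d n : nat) (A S : nat -> set 'rV[R]_d)
    (j : nat) : \bar R :=
  (dist (A j) (S j) * ((n%:R ^+ j)^-1)%:E)%E.

(* For large-scale samplings [S j] is finite and nonempty when [0 < j], so this
   supremum is a maximum. *)
Definition max_dev_ratio (R : realType) (d n : nat)
    (A S : nat -> set 'rV[R]_d) (j : nat) : \bar R :=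
  (ereal_sup [set dev (A j) y | y in S j] * ((n%:R ^+ j)^-1)%:E)%E.

(* Main.v *)
Require Import Defs.
From mathcomp Require Import all_boot all_order all_algebra perm.
From mathcomp Require Import all_classical all_reals all_analysis.
From mathcomp Require Import ring lra zify.

Import Order.TTheory GRing.Theory Num.Theory.
Import numFieldNormedType.Exports.
Local Open Scope classical_set_scope.
Local Open Scope ring_scope.

Set Implicit Arguments.
Unset Strict Implicit.

(** Both sides of the equivalence say the same thing: in every generation [m],
    for any two of the [d + 1] grids and any coordinate direction, the
    hyperplanes orthogonal to that direction which bound the cells of the two
    grids stay at distance at least [e] times the sidelength of the cells, for
    one [e > 0] independent of [m] (the predicate [spread]).

    Spread implies adjacency ([covering_of_spread]). If a cube, small relative
    to the cells of generation [m], lies in no cell of that generation, then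
    each of the [d + 1] grids has a hyperplane cutting it. There are only [d]
    directions, so two grids cut it in the same direction, which puts two of
    their hyperplanes too close to each other.

    Adjacency implies spread ([spread_of_covering]). Suppose that grids [i] and
    [i'] have close hyperplanes in direction [s0]. Match the other [d - 1] grids
    with the other [d - 1] directions and intersect one hyperplane for each
    direction ([corner_point]). A small cube around the intersection point is
    cut by every grid in generation [m]. Generations are nested
    ([progression_nested]), so it is cut in all finer ones too, and only cells
    coarser than those of generation [m] can contain it.

    The same points link spread to the two conditions. For spread grids, the
    points where every grid other than [i] has a wall are exactly those using
    each direction once ([corner_coord]); changing one coordinate of such a
    point leads to a wall of grid [i], and the length of that move is the
    distance between two hyperplanes of one direction. That the vectors are
    far means therefore spread in generations [m >= 0] ([spread_iff_dist]). In
    generation [-j] everything is restricted to a period box of side [n ^ j], where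
    each hyperplane family has one member, its residue. Two residues differ
    by at least [e] periods (the bound on the distances) and by at most [1 - e]
    periods (the bound on [dev]) exactly when the two families, repeated
    with period [n ^ j], keep distance [e * n ^ j] ([gap_of_residues],
    [gap_residues], [spread_iff_ratios]).

    The lower and upper limits see only large [j]; for the finitely many
    other negative generations, nestedness transports the bound of generation
    [0] ([spread_iff_scales]). *)

(** * Arithmetic progressions and their distances *)

(** The hyperplanes of one direction which bound the cells of a generation meet
    the axis of that direction in such a set. *)
Definition progression (R : realType) (c h : R) : set R :=
  [set x | exists k : int, x = c + k%:~R * h].

Lemma progression_shift (R : realType) (c h x : R) (z : int) :
  progression c h x -> progression c h (x + z%:~R * h).
Proof. by case=> k ->; exists (k + z); rewrite intrD; ring. Qed.

Lemma progression_eq (R : realType) (c h x y : R) :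
  progression c h x -> progression c h y -> `|x - y| < h -> x = y.
Proof.
move=> [k ->] [l ->].
have -> : c + k%:~R * h - (c + l%:~R * h) = (k - l)%:~R * h.
  by rewrite intrB; ring.
move=> lth; have h0 : 0 < h by apply: le_lt_trans lth.
move: lth; rewrite normrM (gtr0_norm h0) gtr_pMl// -intr_norm.
rewrite -[1]/(1%:~R) ltr_int => kl.
by have -> : k = l by lia.
Qed.

Lemma progression_gap (R : realType) (c h x y : R) :
  progression c h x -> progression c h y -> x < y -> x + h <= y.
Proof.
move=> cx cy xy; rewrite leNgt; apply/negP => yxh.
have E : x = y by apply: progression_eq cx cy _; rewrite ltr_norml; lra.
by rewrite E ltxx in xy.
Qed.

Lemma progression_floor (R : realType) (c h x : R) : 0 < h ->
  exists2 z, progression c h z & z <= x < z + h.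
Proof.
move=> h0; pose k := Num.floor ((x - c) / h).
exists (c + k%:~R * h); first by exists k.
have /andP[] := floor_itv ((x - c) / h); rewrite -/k intrD.
rewrite ler_pdivlMr// ltr_pdivrMr// => H1 H2.
by apply/andP; split; lra.
Qed.

Lemma progression_residue (R : realType) (c h : R) : 0 < h ->
  exists2 p, progression c h p & 0 <= p < h.
Proof.
move=> h0; have [z [k zE] /andP[zc cz]] := progression_floor 0 c h0.
exists (c - z); last by apply/andP; split; lra.
by exists (- k); rewrite zE mulrNz; ring.
Qed.

(** The distance is measured in periods [h], so that one constant [e] can serve
    all generations. *)
Definition gap (R : realType) (c c' h e : R) : Prop :=
  forall x y, progression c h x -> progression c' h y -> e * h <= `|x - y|.

(** Any difference of elements is [p - q] plus a multiple of [h]. A nonzero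
    multiple has modulus at least [h], which exceeds [`|p - q|] by at least
    [e * h]. *)
Lemma gap_of_residues (R : realType) (c c' h e p q : R) :
  0 <= p < h -> 0 <= q < h -> progression c h p -> progression c' h q ->
  e * h <= `|p - q| -> `|p - q| <= (1 - e) * h -> gap c c' h e.
Proof.
move=> ph qh [kp pE] [kq qE] lo up x y [kx xE] [ky yE].
have : x - y = p - q + (kx - kp - ky + kq)%:~R * h.
  by rewrite xE yE pE qE !(intrD, intrB); ring.
move: (_ - ky + kq) => z ->.
have h0 : 0 < h by case/andP: ph => ? ?; apply: le_lt_trans; eassumption.
have [z0|z0|->] := ltgtP z 0.
- have : (z%:~R : R) <= -1 by rewrite -[1]/(1%:~R) -mulrNz ler_int; lia.
  rewrite -(ler_pM2r h0) => zh.
  move: up; rewrite ler_norml => /andP[u1 u2].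
  by rewrite ler0_norm; lra.
- have : 1 <= (z%:~R : R) by rewrite -[1]/(1%:~R) ler_int; lia.
  rewrite -(ler_pM2r h0) => zh.
  move: up; rewrite ler_norml => /andP[u1 u2].
  by rewrite ger0_norm; lra.
- by rewrite mul0r addr0.
Qed.

(** Moving [p] by one period to either side gives elements on both sides of [q],
    and each of them keeps its distance from [q]. *)
Lemma gap_residues (R : realType) (c c' h e p q : R) :
  0 <= p < h -> 0 <= q < h -> progression c h p -> progression c' h q ->
  gap c c' h e -> `|p - q| <= (1 - e) * h.
Proof.
move=> /andP[p0 ph] /andP[q0 qh] cp cq g.
have := g _ _ (progression_shift 1 cp) cq.
have := g _ _ (progression_shift (-1) cp) cq.
rewrite mulrNz mulN1r mul1r => g1 g2.
move: g1; rewrite ler0_norm; last by lra.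
move: g2; rewrite ger0_norm; last by lra.
by move=> g2 g1; rewrite ler_norml; lra.
Qed.

(** The sidelength of the cells of generation [m]. *)
Definition mesh (R : realType) (n : nat) (m : int) : R := (n%:R ^ m)^-1.

Lemma mesh_gt0 (R : realType) n m : (2 <= n)%N -> 0 < mesh R n m.
Proof. by move=> n2; rewrite invr_gt0 exprz_gt0// ltr0n; lia. Qed.

Lemma meshD (R : realType) n m (k : nat) : (2 <= n)%N ->
  mesh R n m = n%:R ^+ k * mesh R n (m + k%:Z).
Proof.
move=> n2; have n0 : (n%:R : R) != 0 by rewrite pnatr_eq0; lia.
by rewrite /mesh expfzDr// -exprnP invfM mulrCA mulfV ?mulr1// expf_neq0.
Qed.

Lemma mesh_neg (R : realType) n (j : nat) : mesh R n (- j%:Z) = n%:R ^+ j.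
Proof. by rewrite /mesh -exprnN invrK. Qed.

Lemma mesh_lt (R : realType) n m m' : (2 <= n)%N -> m < m' ->
  mesh R n m' < mesh R n m.
Proof.
move=> n2 mm'; have -> : m' = m + `|m' - m|%N%:Z by lia.
rewrite [ltRHS](meshD R m `|m' - m|%N)// ltr_pMl ?mesh_gt0//.
by rewrite exprn_egt1 ?ltr1n//; lia.
Qed.

Lemma mesh_inj (R : realType) n : (2 <= n)%N -> injective (mesh R n).
Proof.
move=> n2 m m' E; have [L|L|//] := ltgtP m m';
by have := mesh_lt R n2 L; rewrite E ltxx.
Qed.

(** A logarithm to base [n]: the smallest power of [n] above [x * n ^ M] works,
    the factor [n ^ M] being there only to make that power exceed [1]. *)
Lemma mesh_bracket (R : realType) n (x : R) : (2 <= n)%N -> 0 < x ->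
  exists2 m, x < mesh R n m & mesh R n m <= n%:R * x.
Proof.
move=> n2 x0.
have small (y : R) : 0 <= y -> exists N, y < n%:R ^+ N.
  move=> y0; exists (Num.bound y).
  apply: lt_trans (archi_boundP y0) _.
  by rewrite -natrX ltr_nat ltn_expl.
have xV0 : 0 <= x^-1 by rewrite invr_ge0 ltW.
have [M xM] := small _ xV0.
have M0 : 0 < (n%:R : R) ^+ M by rewrite exprn_gt0// ltr0n; lia.
have y0 : 0 <= x * n%:R ^+ M by rewrite mulr_ge0// ltW.
have [N xN Nmin] := ex_minnP (small _ y0).
have E k : mesh R n (M%:Z - k%:Z) = n%:R ^+ k / n%:R ^+ M.
  by rewrite (meshD R _ k)// subrK.
exists (M%:Z - N%:Z); rewrite E; first by rewrite ltr_pdivlMr.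
rewrite ler_pdivrMr// -mulrA.
case: N xN Nmin => [|N] xN Nmin.
  by move: xM; rewrite ltNge -[x^-1]mul1r ler_pdivlMr// mulrC (ltW xN).
rewrite exprS ler_pM2l ?ltr0n; last by lia.
by rewrite leNgt; apply/negP => /Nmin; rewrite ltnn.
Qed.

(** * Cubes and their boundaries *)

Lemma hcubeP (R : realType) d (a x : 'rV[R]_d) l :
  hcube a l x <-> forall s, a 0 s <= x 0 s < a 0 s + l.
Proof. by split=> H s; move: (H s); rewrite in_itv. Qed.

Lemma row_choice (T : Type) d (P : 'I_d -> T -> Prop) :
  (forall s, exists t, P s t) -> exists a : 'rV[T]_d, forall s, P s (a 0 s).
Proof.
move=> /boolp.choice[f Pf]; exists (\row_s f s) => s.
by rewrite mxE; exact: Pf.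
Qed.

Lemma coordD_delta (R : realType) d (x : 'rV[R]_d) (t : R) (k s : 'I_d) :
  (x + t *: delta_mx 0 k) 0 s = x 0 s + t *+ (s == k).
Proof. by rewrite !mxE eqxx /= mulr_natr. Qed.

Lemma is_cube_hcube (R : realType) d (a : 'rV[R]_d) l :
  0 < l -> is_cube (hcube a l) l.
Proof.
move=> l0; split=> //; exists a, (fun=> true), (fun=> true).
by [].
Qed.

Lemma is_cube_closed (R : realType) d (a : 'rV[R]_d) l :
  0 < l -> is_cube [set x : 'rV[R]_d | forall s, a 0 s <= x 0 s <= a 0 s + l] l.
Proof.
move=> l0; split=> //; exists a, (fun=> true), (fun=> false).
by apply/seteqP; split=> x H s; move: (H s); rewrite in_itv.
Qed.

(** Replaces the four kinds of intervals by comparison with the open and the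
    closed cube. *)
Lemma is_cube_bounds (R : realType) d (Q : set 'rV[R]_d) l : is_cube Q l ->
  exists a : 'rV[R]_d,
    (forall x : 'rV[R]_d, Q x -> forall s, a 0 s <= x 0 s <= a 0 s + l) /\
    (forall x : 'rV[R]_d, (forall s, a 0 s < x 0 s < a 0 s + l) -> Q x).
Proof.
case=> l0 [a [p [q ->]]]; exists a; split=> x H s; have := H s.
  by case: (p s) (q s) => -[]; rewrite in_itv/= => /andP[? ?];
    apply/andP; split=> //; exact: ltW.
by case: (p s) (q s) => -[] /andP[? ?]; rewrite in_itv/=;
  apply/andP; split=> //; exact: ltW.
Qed.

(** Unless the sides agree, the larger cube contains two points of a diagonal
    that are too far apart for the smaller one. *)
Lemma is_cube_hcube_side (R : realType) d (a : 'rV[R]_d) l r : (1 <= d)%N ->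
  0 < l -> is_cube (hcube a l) r -> r = l.
Proof.
move=> d1 l0 cr; have r0 : 0 < r by case: cr.
have [b [inb bin]] := is_cube_bounds cr.
pose s : 'I_d := Ordinal d1.
have [rl|lr|//] := ltgtP r l.
- have in1 : hcube a l a by apply/hcubeP => u; lra.
  have in2 : hcube a l (a + const_mx ((l + r) / 2)).
    by apply/hcubeP => u; rewrite !mxE; lra.
  have := inb _ in1 s; have := inb _ in2 s; rewrite !mxE; lra.
- pose e := (r - l) / 2.
  have in1 : hcube a l (b + const_mx e).
    by refine (bin _ _) => u; rewrite !mxE /e; lra.
  have in2 : hcube a l (b + const_mx (r - e)).
    by refine (bin _ _) => u; rewrite !mxE /e; lra.
  move/hcubeP: in1 => /(_ s); move/hcubeP: in2 => /(_ s).
  by rewrite !mxE /e; lra.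
Qed.

Lemma closure_hcube (R : realType) d (a x : 'rV[R]_d) l :
  closure (hcube a l) x -> forall s, a 0 s <= x 0 s <= a 0 s + l.
Proof.
move=> cl s; apply/andP; split; rewrite leNgt; apply/negP => xs.
- have N : \forall y \near x, (y : 'rV[R]_d) 0 s < a 0 s.
    exact: (cvgr_lt _ (@coord_continuous R 1 d 0 s x)).
  by have [y [/hcubeP/(_ s) ay]] := cl _ N; rewrite /=; lra.
- have N : \forall y \near x, a 0 s + l < (y : 'rV[R]_d) 0 s.
    exact: (cvgr_gt _ (@coord_continuous R 1 d 0 s x)).
  by have [y [/hcubeP/(_ s) ay]] := cl _ N; rewrite /=; lra.
Qed.

Lemma interior_hcube (R : realType) d (a x : 'rV[R]_d) l :
  (hcube a l)° x <-> forall s, a 0 s < x 0 s < a 0 s + l.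
Proof.
split=> [Ix s|H].
- have /hcubeP/(_ s)/andP[ax ->] := interior_subset Ix; rewrite andbT.
  move: Ix => /nbhs_ballP[e /= e0 xe].
  have /xe/hcubeP/(_ s) : ball x e (x + (- (e / 2)) *: delta_mx 0 s).
    split=> // i j; rewrite !ord1 /ball /= coordD_delta opprD addrA subrr.
    rewrite add0r normrN normrMn normrN gtr0_norm; last by lra.
    by case: (_ == _); rewrite ?mulr0n ?mulr1n; lra.
  by rewrite coordD_delta eqxx mulr1n; lra.
- suff : \forall y \near x, forall s, a 0 s < (y : 'rV[R]_d) 0 s < a 0 s + l.
    apply: filterS => y ay; apply/hcubeP => s.
    by have /andP[/ltW -> ->] := ay s.
  suff coord s : \forall y \near x, a 0 s < (y : 'rV[R]_d) 0 s < a 0 s + l.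
    exact: (filter_forall _ coord).
  have /andP[ax xa] := H s.
  near=> y; apply/andP; split; near: y.
  + exact: (cvgr_gt _ (@coord_continuous R 1 d 0 s x)).
  + exact: (cvgr_lt _ (@coord_continuous R 1 d 0 s x)).
Unshelve. all: by end_near.
Qed.

(** * The cells of one generation *)

Lemma offset_cubesP (R : realType) d n (v : 'rV[R]_d) m (Q : set 'rV[R]_d) :
  offset_cubes n v m Q <->
  exists2 a : 'rV[R]_d, forall s, progression (v 0 s) (mesh R n m) (a 0 s)
           & Q = hcube a (mesh R n m).
Proof.
split=> [[k ->]|[a /row_choice[k ak] ->]].
  by eexists; last reflexivity; move=> s; rewrite mxE; exists (k 0 s).
by exists k; congr hcube; apply/rowP => s; rewrite mxE ak.
Qed.

Lemma cell_at (R : realType) d (v x : 'rV[R]_d) h : 0 < h ->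
  exists2 a : 'rV[R]_d, forall s, progression (v 0 s) h (a 0 s) & hcube a h x.
Proof.
move=> h0.
have /row_choice[a Pa] s : exists z,
    progression (v 0 s) h z /\ z <= x 0 s < z + h.
  by have [z] := progression_floor (v 0 s) (x 0 s) h0; exists z.
by exists a => [s|]; [|apply/hcubeP => s]; case: (Pa s).
Qed.

(** The union of the hyperplanes that bound the cells of side [h] of the grid
    shifted by [v]. *)
Definition walls (R : realType) d (v : 'rV[R]_d) (h : R) : set 'rV[R]_d :=
  [set x | exists s, progression (v 0 s) h (x 0 s)].

(** A point on a hyperplane is a boundary point of the cell that contains it,
    since the hyperplane can only meet that cell in its lower face. *)
Lemma boundaries_offset_cubes (R : realType) d n (v : 'rV[R]_d) m :
  (2 <= n)%N -> boundaries (offset_cubes n v m) = walls v (mesh R n m).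
Proof.
move=> n2; set h := mesh R n m; have h0 : 0 < h by exact: mesh_gt0.
apply/seteqP; split=> x.
- case=> _ /offset_cubesP[a Pa ->] [/closure_hcube cl nint].
  apply: contrapT => nw; apply: nint; apply/interior_hcube => s.
  have /andP[l1 l2] := cl s.
  rewrite !lt_neqAle l1 l2 !andbT; apply/andP; split; apply/eqP => E;
    apply: nw; exists s; rewrite -/h in Pa.
  + by rewrite -E.
  + by have := progression_shift 1 (Pa s); rewrite mul1r -E.
- case=> s ps.
  have [a Pa xa] := cell_at v x h0.
  exists (hcube a h); first by apply/offset_cubesP; exists a.
  split; first exact: subset_closure.
  move=> /interior_hcube/(_ s)/andP[ax xah].
  by have := progression_gap (Pa s) ps ax; lra.
Qed.

(** * Nestedness of the generations *)

Lemma offset_neg (R : realType) d (delta : 'rV[R]_d) (L : nat -> 'rV[int]_d)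
    (j : nat) (s : 'I_d) : L 0%N = 0 ->
  offset delta L (- j%:Z) 0 s = delta 0 s + (L j 0 s)%:~R.
Proof.
move=> L0; rewrite /offset; case: ifP => [j0|_]; last by rewrite abszN !mxE.
have -> : j = 0%N by lia.
by rewrite L0 mxE addr0.
Qed.

Lemma location0 d n (a : nat -> 'I_d -> 'I_n) : location a 0 = 0.
Proof. by apply/rowP => s; rewrite !mxE big_ord0. Qed.

Lemma locationS d n (a : nat -> 'I_d -> 'I_n) j s :
  location a j.+1 0 s = location a j 0 s + n%:Z ^+ j * (a j s : nat)%:Z.
Proof. by rewrite !mxE big_ord_recr. Qed.

(** For [m >= 0] the offset is constant and the mesh is divided by [n]. From
    generation [- p.+1] to [- p] the offset changes by [n ^ p * a p], a multiple
    of the finer mesh [n ^ p]. *)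
Lemma progression_succ (R : realType) d n (delta : 'rV[R]_d)
    (a : nat -> 'I_d -> 'I_n) m (s : 'I_d) : (2 <= n)%N ->
  progression (offset delta (location a) m 0 s) (mesh R n m) `<=`
  progression (offset delta (location a) (m + 1) 0 s) (mesh R n (m + 1)).
Proof.
move=> n2 x [k ->]; rewrite (meshD R m 1)// expr1.
case: m => p.
  exists (k * n%:Z); rewrite intrM /offset.
  have -> : 0 <= Posz p + 1 by lia.
  have -> : 0 <= Posz p by lia.
  by rewrite -!pmulrn; ring.
have -> : Negz p = - p.+1%:Z by lia.
have -> : - p.+1%:Z + 1 = - p%:Z by lia.
rewrite !offset_neg ?location0// locationS mesh_neg.
exists ((a p s : nat)%:Z + k * n%:Z).
rewrite !(intrD, intrM) !rmorphXn /= -!pmulrn; ring.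
Qed.

Lemma progression_nested (R : realType) d n (delta : 'rV[R]_d)
    (a : nat -> 'I_d -> 'I_n) (m m' : int) (s : 'I_d) : (2 <= n)%N -> m <= m' ->
  progression (offset delta (location a) m 0 s) (mesh R n m) `<=`
  progression (offset delta (location a) m' 0 s) (mesh R n m').
Proof.
move=> n2 mm'; have -> : m' = m + `|m' - m|%N%:Z by lia.
elim: `|m' - m|%N => [|k IH]; first by rewrite addr0.
have -> : m + k.+1%:Z = (m + k%:Z) + 1 by lia.
by move=> x /IH; exact: progression_succ.
Qed.

(** A face of the coarse cell that separated two points of the fine cell would
    lie on a hyperplane of the fine generation interior to the fine cell. *)
Lemma generation_nested (R : realType) d n (delta : 'rV[R]_d)
    (a : nat -> 'I_d -> 'I_n) (m m' : int) (P Q : set 'rV[R]_d) :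
  (2 <= n)%N -> m <= m' ->
  generation n delta (location a) m P -> generation n delta (location a) m' Q ->
  P `&` Q !=set0 -> Q `<=` P.
Proof.
move=> n2 mm' /offset_cubesP[p Pp ->] /offset_cubesP[q Qq ->].
move=> [x [/hcubeP xp /hcubeP xq]] y /hcubeP yq.
apply/hcubeP => s; have xps := xp s; have xqs := xq s; have yqs := yq s.
have pm' := progression_nested n2 mm' (Pp s).
have phm' := progression_nested n2 mm' (progression_shift 1 (Pp s)).
rewrite mul1r in phm'.
apply/andP; split.
- rewrite leNgt; apply/negP => ys.
  by have := progression_gap (Qq s) pm'; lra.
- rewrite ltNge; apply/negP => ys.
  by have := progression_gap (Qq s) phm'; lra.
Qed.

Lemma generation_cube (R : realType) d n (delta : 'rV[R]_d)
    (L : nat -> 'rV[int]_d) m (Q : set 'rV[R]_d) : (2 <= n)%N ->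
  generation n delta L m Q -> is_cube Q (mesh R n m).
Proof.
by move=> n2 /offset_cubesP[a _ ->]; apply: is_cube_hcube; exact: mesh_gt0.
Qed.

Lemma generation_index (R : realType) d n (delta : 'rV[R]_d)
    (L : nat -> 'rV[int]_d) m k (Q : set 'rV[R]_d) : (1 <= d)%N -> (2 <= n)%N ->
  generation n delta L m Q -> is_cube Q (n%:R ^ k) -> m = - k.
Proof.
move=> d1 n2 /offset_cubesP[a _ ->].
move=> /(is_cube_hcube_side d1 (mesh_gt0 R m n2)) E.
by apply: (mesh_inj (R := R) n2); rewrite -E /mesh -invr_expz invrK.
Qed.

Lemma generation_cover (R : realType) d n (delta x : 'rV[R]_d)
    (L : nat -> 'rV[int]_d) m : (2 <= n)%N ->
  exists2 Q, generation n delta L m Q & Q x.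
Proof.
move=> n2; have [a Pa xa] := cell_at (offset delta L m) x (mesh_gt0 R m n2).
by eexists; [apply/offset_cubesP; exists a; [exact: Pa|reflexivity]|].
Qed.

Lemma nadic_grid_grid (R : realType) d n (delta : 'rV[R]_d)
    (a : nat -> 'I_d -> 'I_n) : (1 <= d)%N -> (2 <= n)%N ->
  nadic_grid n (grid n delta (location a)).
Proof.
move=> d1 n2; split.
- move=> Q [m _ /offset_cubesP[p _ ->]]; exists p, (- m).
  by rewrite /mesh invr_expz.
- move=> P Q [m _ Pm] [m' _ Qm'].
  have [->|/set0P PQ] := eqVneq (P `&` Q) set0; first by constructor 3.
  have [mm'|m'm] := leP m m'.
  + by constructor 2; apply: setIidr; exact: generation_nested mm' Pm Qm' PQ.
  + constructor 1; apply: setIidl.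
    by apply: (generation_nested n2 (ltW m'm) Qm' Pm); rewrite setIC.
- move=> k; split.
  + apply/seteqP; split=> x // _.
    have [Q GQ Qx] := generation_cover delta x (location a) (- k) n2.
    exists Q => //; split; first by exists (- k).
    by have := generation_cube n2 GQ; rewrite /mesh invr_expz opprK.
  + move=> P Q [[m _ Pm] cP] [[m' _ Qm'] cQ] PQ.
    have mk := generation_index d1 n2 Pm cP.
    have m'k := generation_index d1 n2 Qm' cQ.
    rewrite {}mk in Pm; rewrite {}m'k in Qm'.
    apply/seteqP; split.
      by apply: (generation_nested n2 (lexx _) Qm' Pm); rewrite setIC.
    exact: (generation_nested n2 (lexx _) Pm Qm' PQ).
  + move=> Q [[m _ /offset_cubesP[p _ ->]] _]; exists p; apply/hcubeP => s.
    by have := mesh_gt0 R m n2; lra.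
Qed.

(** * Distances *)

Lemma enorm_ge_coord (R : realType) d (x : 'rV[R]_d) s : `|x 0 s| <= enorm x.
Proof.
rewrite -sqrtr_sqr ler_sqrt ?sqr_ge0//; last first.
  by apply: sumr_ge0 => u _; exact: sqr_ge0.
by rewrite (bigD1 s)//= lerDl; apply: sumr_ge0 => u _; exact: sqr_ge0.
Qed.

Lemma enorm_delta (R : realType) d (t : R) (k : 'I_d) :
  enorm (t *: delta_mx 0 k) = `|t|.
Proof.
rewrite /enorm (bigD1 k)//= big1 => [|s /negbTE sk].
  by rewrite !mxE !eqxx mulr1 addr0 sqrtr_sqr.
by rewrite !mxE sk andbF mulr0 expr0n.
Qed.

Lemma dist_geP (R : realType) d (A B : set 'rV[R]_d) (c : R) :
  (c%:E <= dist A B)%E <->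
  forall x y, A x -> B y -> c <= enorm (x - y).
Proof.
split=> [cd x y Ax By|H].
  rewrite -lee_fin; apply: le_trans cd _; apply: ereal_inf_lbound.
  by exists x => //; exists y.
by apply: le_ereal_inf_tmp => _ [x Ax [y By <-]]; rewrite lee_fin; exact: H.
Qed.

Lemma dist_dir_le (R : realType) d k (A : set 'rV[R]_d) x t :
  A (x + t *: delta_mx 0 k) -> (dist_dir k A x <= `|t|%:E)%E.
Proof. by move=> At; apply: ereal_inf_lbound; exists t. Qed.

Lemma dist_dir_geP (R : realType) d k (A : set 'rV[R]_d) x (c : R) :
  (c%:E <= dist_dir k A x)%E <->
  forall t, A (x + t *: delta_mx 0 k) -> c <= `|t|.
Proof.
split=> [cd t At|H].
  by rewrite -lee_fin; apply: le_trans cd _; exact: dist_dir_le.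
by apply: le_ereal_inf_tmp => _ [t At <-]; rewrite lee_fin; exact: H.
Qed.

Lemma dist_dir_le_dev (R : realType) d k (A : set 'rV[R]_d) x :
  (dist_dir k A x <= dev A x)%E.
Proof. exact: (le_bigmax _ (fun k => dist_dir k A x) k). Qed.

Lemma dist_le_dist_dir (R : realType) d k (A B : set 'rV[R]_d) y :
  B y -> (dist A B <= dist_dir k A y)%E.
Proof.
move=> By; apply: le_ereal_inf_tmp => _ [t At <-].
apply: ereal_inf_lbound; exists (y + t *: delta_mx 0 k) => //; exists y => //.
by rewrite addrC addKr enorm_delta.
Qed.

(** * Spread families of hyperplanes *)

Definition spread (R : realType) d (v : 'I_d.+1 -> 'rV[R]_d) (h e : R) : Prop :=
  forall i i' s, i != i' -> gap (v i 0 s) (v i' 0 s) h e.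

Definition corners (R : realType) d (v : 'I_d.+1 -> 'rV[R]_d) (h : R)
    (i : 'I_d.+1) : set 'rV[R]_d :=
  [set y | forall k, walls (v (lift i k)) h y].

(** The transposition of [s0] and [k0] matches directions with the grids other
    than [i], sending [s0] to grid [lift i k0]; each coordinate is then chosen on
    a hyperplane of the matched grid. Only coordinate [s0] is prescribed, the
    others can be residues, so that the point lies in the period box when [y]
    does. *)
Lemma corner_point (R : realType) d (v : 'I_d.+1 -> 'rV[R]_d) h i k0 s0 y :
  0 < h -> progression (v (lift i k0) 0 s0) h y ->
  exists Y : 'rV[R]_d, [/\ corners v h i Y, Y 0 s0 = y
                       & forall s, s != s0 -> 0 <= Y 0 s < h].
Proof.
move=> h0 py; pose tau := tperm s0 k0.
have /row_choice[Y HY] s : exists t, progression (v (lift i (tau s)) 0 s) h t /\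
    if s == s0 then t = y else 0 <= t < h.
  have [->|ne] := eqVneq s s0; first by exists y; rewrite /tau tpermL.
  by have [p] := progression_residue (v (lift i (tau s)) 0 s) h0; exists p.
exists Y; split.
- move=> k; exists (tau k); rewrite -{1}[k](tpermK s0 k0).
  by have [] := HY (tau k).
- by have [_] := HY s0; rewrite eqxx.
- by move=> s /negbTE ss0; have [_] := HY s; rewrite ss0.
Qed.

(** Two grids cannot have a common hyperplane, so the directions of the [d] walls
    through a corner are pairwise distinct, hence exhaust all directions. *)
Lemma corner_coord (R : realType) d (v : 'I_d.+1 -> 'rV[R]_d) h e i Y s :
  0 < e * h -> spread v h e -> corners v h i Y ->
  exists k, progression (v (lift i k) 0 s) h (Y 0 s).
Proof.
move=> eh sp /boolp.choice[f Pf].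
have finj : injective f.
  move=> k k' E; apply/eqP; apply: contraT => kk'.
  have := sp (lift i k) (lift i k') (f k).
  rewrite (inj_eq lift_inj) kk' => /(_ isT _ _ (Pf k)).
  by rewrite E => /(_ _ (Pf k')); rewrite subrr normr0; lra.
by exists (invF finj s); have := Pf (invF finj s); rewrite f_invF.
Qed.

(** The distance from a corner to a wall of grid [i] is at least that between
    two hyperplanes of one direction, and moving a corner along that direction
    realizes any such distance. *)
Lemma spread_iff_dist (R : realType) d (v : 'I_d.+1 -> 'rV[R]_d) h e :
  0 < h -> 0 < e ->
  spread v h e <->
  forall i, ((e * h)%:E <= dist (walls (v i) h) (corners v h i))%E.
Proof.
move=> h0 e0; split=> [sp i|H].
  apply/dist_geP => x y [s xs] cy.
  have [k ys] := corner_coord s (mulr_gt0 e0 h0) sp cy.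
  apply: le_trans (enorm_ge_coord _ s); rewrite !mxE.
  exact: (sp _ _ _ (neq_lift i k) _ _ xs ys).
move=> i i' s; have [k -> _|->] := unliftP i i'; last by rewrite eqxx.
move=> x y px py; have [Y [cY Ys _]] := corner_point h0 py.
have /dist_geP/(_ (Y + (x - y) *: delta_mx 0 s) Y) := H i.
rewrite [Y + _ - Y]addrAC subrr add0r enorm_delta; apply=> //; exists s.
by rewrite coordD_delta eqxx mulr1n Ys addrC subrK.
Qed.

Lemma hcube0P (R : realType) d h (x : 'rV[R]_d) :
  hcube 0 h x <-> forall s, 0 <= x 0 s < h.
Proof.
by split=> [/hcubeP H s|H]; [|apply/hcubeP => s]; move: (H s); rewrite mxE add0r.
Qed.

(** In each direction the box contains a wall of grid [i] at the residue of that
    grid. The corner has there the residue of another grid, and two residues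
    are at most [(1 - e) * h] apart. *)
Lemma spread_box (R : realType) d (v : 'I_d.+1 -> 'rV[R]_d) h e i :
  0 < h -> 0 < e -> spread v h e ->
  let A := walls (v i) h `&` hcube 0 h in
  let S := corners v h i `&` hcube 0 h in
  ((e * h)%:E <= dist A S)%E /\
  forall y, S y -> (dev A y <= ((1 - e) * h)%:E)%E.
Proof.
move=> h0 e0 sp A S; split.
  have /spread_iff_dist/(_ i)/dist_geP H := sp.
  by apply/dist_geP => x y [Ax _] [Sy _]; exact: H.
move=> y [cy /hcube0P yb]; apply: bigmax_le => [|k _]; first exact: leNye.
have [p pk pb] := progression_residue (v i 0 k) h0.
have [l yl] := corner_coord k (mulr_gt0 e0 h0) sp cy.
have := gap_residues pb (yb k) pk yl (sp _ _ _ (neq_lift i l)).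
rewrite -lee_fin; apply: le_trans; apply: dist_dir_le; split.
  by exists k; rewrite coordD_delta eqxx mulr1n addrC subrK.
apply/hcube0P => s; rewrite coordD_delta.
have [->|_] := eqVneq s k; first by rewrite mulr1n addrC subrK.
by rewrite mulr0n addr0.
Qed.

(** At the corner [Y] with residue [q] in direction [s], the lower bound keeps [Y]
    off the walls of grid [i] in the other directions. So the only wall that a
    move in direction [s] inside the box can reach is the residue [p], and both
    bounds become bounds on [`|p - q|]. *)
Lemma spread_of_box (R : realType) d (v : 'I_d.+1 -> 'rV[R]_d) h e :
  0 < h -> 0 < e ->
  (forall i, let A := walls (v i) h `&` hcube 0 h in
     let S := corners v h i `&` hcube 0 h in
     ((e * h)%:E <= dist A S)%E /\
     forall y, S y -> (dev A y <= ((1 - e) * h)%:E)%E) ->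
  spread v h e.
Proof.
move=> h0 e0 H i i' s; have [k -> _|->] := unliftP i i'; last by rewrite eqxx.
have [p pp pb] := progression_residue (v i 0 s) h0.
have [q pq qb] := progression_residue (v (lift i k) 0 s) h0.
have [Y [cY Ys Yb]] := corner_point h0 pq.
have Ybox : hcube 0 h Y.
  by apply/hcube0P => u; have [->|/Yb//] := eqVneq u s; rewrite Ys.
have [/dist_geP lo up] := H i.
have Xbox : hcube 0 h (Y + (p - q) *: delta_mx 0 s).
  apply/hcube0P => u; rewrite coordD_delta.
  have [->|/Yb] := eqVneq u s; last by rewrite mulr0n addr0.
  by rewrite mulr1n Ys addrC subrK.
apply: (gap_of_residues pb qb pp pq).
  have := lo (Y + (p - q) *: delta_mx 0 s) Y.
  rewrite [Y + _ - Y]addrAC subrr add0r enorm_delta; apply; split=> //.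
  by exists s; rewrite coordD_delta eqxx mulr1n Ys addrC subrK.
rewrite -lee_fin; apply: le_trans (up Y _); last by [].
apply: le_trans (dist_dir_le_dev s _ _); apply/dist_dir_geP => t [[u wu] tb].
have Ytb := hcube0P h (Y + t *: delta_mx 0 s).
move: wu; rewrite coordD_delta; have [->{u} wu|us] := eqVneq u s.
  have E : p = Y 0 s + t.
    rewrite mulr1n in wu; apply: progression_eq pp wu _.
    by have := proj1 Ytb tb s; rewrite coordD_delta eqxx mulr1n ltr_norml; lra.
  by rewrite E Ys addrAC subrr add0r.
rewrite mulr0n addr0 => wu.
(* A wall of grid [i] in another direction would put Y at
   distance 0 from the walls. *)
have := lo Y Y; rewrite subrr.
move=> /(_ (conj (ex_intro _ u wu) Ybox) (conj cY Ybox)).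
have -> : enorm (0 : 'rV[R]_d) = 0.
  by have := enorm_delta (0 : R) s; rewrite scale0r normr0.
by rewrite leNgt mulr_gt0.
Qed.

(** * Adjacency *)

Definition offsets (R : realType) d n (delta : 'I_d.+1 -> 'rV[R]_d)
    (a : 'I_d.+1 -> nat -> 'I_d -> 'I_n) (m : int) (i : 'I_d.+1) : 'rV[R]_d :=
  offset (delta i) (location (a i)) m.

(** Otherwise each of the [d + 1] grids has a hyperplane through the closure of
    [Q]; by the pigeonhole principle two of these have the same direction, at
    distance at most [l]. *)
Lemma covering_of_spread (R : realType) d n (v : 'I_d.+1 -> 'rV[R]_d)
    (m : int) (e l : R) (Q : set 'rV[R]_d) :
  (2 <= n)%N -> spread v (mesh R n m) e -> l < e * mesh R n m -> is_cube Q l ->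
  exists i P, offset_cubes n (v i) m P /\ Q `<=` P.
Proof.
move=> n2 sp lh cQ; have h0 := mesh_gt0 R m n2.
set h := mesh R n m in sp lh h0 *.
have l0 : 0 < l by case: cQ.
have [b [bQ inQ]] := is_cube_bounds cQ.
pose c := b + const_mx (l / 2).
have cc s : c 0 s = b 0 s + l / 2 by rewrite !mxE.
have Qc : Q c by refine (inQ _ _) => s; rewrite cc; lra.
apply: contrapT => ncov.
have /boolp.choice[f Pf] i : exists s, exists2 z,
    progression (v i 0 s) h z & b 0 s <= z <= b 0 s + l.
  (* Some point of Q leaves the cell of the centre c through a face. *)
  have [p Pp /hcubeP pc] := cell_at (v i) c h0.
  apply: contrapT => nz; apply: ncov; exists i, (hcube p h).
  split; first by apply/offset_cubesP; exists p.
  move=> y Qy; apply/hcubeP => s; have yb := bQ _ Qy s.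
  have pcs := pc s; rewrite cc in pcs.
  apply/andP; split.
  - rewrite leNgt; apply/negP => yp; apply: nz; exists s, (p 0 s) => //; lra.
  - rewrite ltNge; apply/negP => yp; apply: nz; exists s, (p 0 s + h);
      last by lra.
    by have := progression_shift 1 (Pp s); rewrite mul1r.
have : ~~ injectiveb f.
  apply/negP => /injectiveP/leq_card; rewrite !card_ord; lia.
case/injectivePn => i [i' ii' E].
have [z pz zb] := Pf i; have [z' pz' zb'] := Pf i'; rewrite -{}E in pz' zb'.
have := sp _ _ _ ii' _ _ pz pz'; apply/negP; rewrite -ltNge.
by apply: le_lt_trans lh; rewrite ler_norml; lra.
Qed.

(** The test cube is centred at a corner and has side [h / C]. It is cut by all
    grids in generation [m], hence in all finer ones, while a cell allowed by
    the covering property has side at most [h] and so belongs to generation [m]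
    or to a finer one. *)
Lemma spread_of_covering (R : realType) d n (delta : 'I_d.+1 -> 'rV[R]_d)
    (a : 'I_d.+1 -> nat -> 'I_d -> 'I_n) (C : R) :
  (1 <= d)%N -> (2 <= n)%N -> 0 < C ->
  (forall (Q : set 'rV[R]_d) (l : R), is_cube Q l ->
     exists (i : 'I_d.+1) (P : set 'rV[R]_d) (r : R),
       [/\ grid n (delta i) (location (a i)) P, is_cube P r, Q `<=` P
         & r <= C * l]) ->
  forall m, spread (offsets delta a m) (mesh R n m) (2 * C)^-1.
Proof.
move=> d1 n2 C0 cov m i i' s0.
have [k -> _|->] := unliftP i i'; last by rewrite eqxx.
move=> x y px py; rewrite leNgt; apply/negP.
have h0 := mesh_gt0 R m n2; set h := mesh R n m in px py h0 *.
set r := _ * h => xy.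
have r0 : 0 < r by rewrite mulr_gt0// invr_gt0 mulr_gt0.
have rC : C * (2 * r) = h by rewrite /r; field; lra.
have [Y [cY Ys _]] := corner_point h0 py.
pose b := Y - const_mx r; have bE s : b 0 s = Y 0 s - r by rewrite !mxE.
have cQ : is_cube [set z : 'rV[R]_d | forall s, b 0 s <= z 0 s <= b 0 s + 2 * r]
    (2 * r) by apply: is_cube_closed; lra.
have [i1 [P [t [[m' _ /offset_cubesP[p Pp PE]] cP QP tl]]]] := cov _ _ cQ.
rewrite {}rC in tl.
rewrite {}PE in cP QP.
have tE := is_cube_hcube_side d1 (mesh_gt0 R m' n2) cP.
(* Grid [i] cuts the test cube at [x], any other grid at a coordinate of [Y]. *)
have [s [z [pz zb]]] : exists s z,
    progression (offsets delta a m i1 0 s) h z /\ b 0 s < z < b 0 s + 2 * r.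
  have [j ->|->] := unliftP i i1.
    by have [s Ps] := cY j; exists s, (Y 0 s); rewrite bE; split=> //; lra.
  exists s0, x; rewrite bE Ys; split=> //.
  by move: xy; rewrite ltr_norml; lra.
have /hcubeP/(_ s) pb : hcube p (mesh R n m') b by apply: QP => u; lra.
have /hcubeP/(_ s) : hcube p (mesh R n m') (b + const_mx (2 * r)).
  by apply: QP => u; rewrite [X in _ <= X <= _]mxE [X in _ + X]mxE; lra.
rewrite [X in _ <= X < _]mxE [X in _ + X]mxE => pb'.
(* A cell coarser than generation [m] has side larger than [h = C * (2 * r)]. *)
have [mm'|m'm] := leP m m'; last by have := mesh_lt R n2 m'm; rewrite -/h; lra.
have := progression_gap (Pp s) (progression_nested n2 mm' pz); lra.
Qed.

Lemma adjacent_iff_spread (R : realType) d n (delta : 'I_d.+1 -> 'rV[R]_d)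
    (a : 'I_d.+1 -> nat -> 'I_d -> 'I_n) : (1 <= d)%N -> (2 <= n)%N ->
  adjacent_grids n (fun i => grid n (delta i) (location (a i))) <->
  exists2 e, 0 < e & forall m, spread (offsets delta a m) (mesh R n m) e.
Proof.
move=> d1 n2; split=> [[_ [C [C0 cov]]]|[e e0 sp]].
  exists (2 * C)^-1; first by rewrite invr_gt0 mulr_gt0.
  exact: spread_of_covering cov.
split=> [i|]; first exact: nadic_grid_grid.
exists (n%:R / e); split; first by rewrite divr_gt0// ltr0n; lia.
move=> Q l cQ; have l0 : 0 < l by case: cQ.
have [m lm ml] := mesh_bracket n2 (divr_gt0 l0 e0).
have [|i [P [Pm QP]]] := covering_of_spread n2 (sp m) _ cQ.
  by rewrite mulrC -ltr_pdivrMr.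
exists i, P, (mesh R n m); split=> //.
- by exists m.
- exact: generation_cube Pm.
- by rewrite mulrAC -mulrA.
Qed.

(** * Bounds on lower and upper limits *)

Lemma limn_einf_ge (R : realType) (u : nat -> \bar R) (c : \bar R) :
  (forall j, (c <= u j)%E) -> (c <= limn_einf u)%E.
Proof.
move=> cu; rewrite limn_einf_lim; apply: lime_ge; first exact: is_cvg_einfs.
by apply: nearW => N; apply: le_ereal_inf_tmp => _ [j _ <-].
Qed.

Lemma limn_esup_le (R : realType) (u : nat -> \bar R) (c : \bar R) :
  (forall j, (u j <= c)%E) -> (limn_esup u <= c)%E.
Proof.
move=> uc; rewrite limn_esup_lim; apply: lime_le; first exact: is_cvg_esups.
by apply: nearW => N; apply/ereal_supP => _ [j _ <-].
Qed.

Lemma limn_einf_le_esup (R : realType) (u w : nat -> \bar R) :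
  (forall j, (u j <= w j)%E) -> (limn_einf u <= limn_esup w)%E.
Proof.
move=> uw; rewrite limn_einf_lim limn_esup_lim.
apply: lee_lim; [exact: is_cvg_einfs|exact: is_cvg_esups|].
apply: nearW => N; apply: (@le_trans _ _ (u N)).
  by apply: ereal_inf_lbound; exists N => //=.
by apply: (le_trans (uw N)); apply: ereal_sup_ubound; exists N => //=.
Qed.

Lemma limn_einf_gt (R : realType) (u : nat -> \bar R) (c : \bar R) :
  (c < limn_einf u)%E -> \forall j \near \oo, (c < u j)%E.
Proof.
rewrite limn_einf_lim (cvg_lim _ (@cvg_einfs_sup _ u))//.
move=> /ereal_sup_gt[_ [N _ <-] cN]; exists N => // j /= Nj.
by apply: lt_le_trans cN _; apply: ereal_inf_lbound; exists j.
Qed.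

Lemma limn_esup_lt (R : realType) (u : nat -> \bar R) (c : \bar R) :
  (limn_esup u < c)%E -> \forall j \near \oo, (u j < c)%E.
Proof.
rewrite limn_esup_lim (cvg_lim _ (@cvg_esups_inf _ u))//.
move=> /ereal_inf_lt[_ [N _ <-] cN]; exists N => // j /= Nj.
by apply: le_lt_trans _ cN; apply: ereal_sup_ubound; exists j.
Qed.

Lemma lt0e_gap (R : realType) (x : \bar R) :
  (0 < x)%E -> exists2 e : R, 0 < e & (e%:E < x)%E.
Proof.
case: x => [r|_|//]; last by exists 1; rewrite ?ltry.
by rewrite lte_fin => r0; exists (r / 2); rewrite ?lte_fin; lra.
Qed.

Lemma lte1_gap (R : realType) (x : \bar R) :
  (x < 1)%E -> exists2 e : R, 0 < e & (x < (1 - e)%:E)%E.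
Proof.
case: x => [r|//|_]; last by exists 1; rewrite ?ltNyr.
by rewrite lte_fin => r1; exists ((1 - r) / 2); rewrite ?lte_fin; lra.
Qed.

Lemma uniform_positive (R : realType) N (P : 'I_N -> R -> Prop) :
  (forall i e e', e' <= e -> P i e -> P i e') ->
  (forall i, exists2 e, 0 < e & P i e) ->
  exists2 e, 0 < e & forall i, P i e.
Proof.
move=> Pmono H; have /boolp.choice[f Pf] i : exists e, 0 < e /\ P i e.
  by have [e] := H i; exists e.
exists (\big[Num.min/1]_i f i).
  by apply/lt_bigmin => // i _; case: (Pf i).
by move=> i; case: (Pf i) => _; apply: Pmono; exact: bigmin_le.
Qed.

(** * Small and large scale conditions *)

Lemma spread_le (R : realType) d (v : 'I_d.+1 -> 'rV[R]_d) h e e' :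
  0 < h -> e' <= e -> spread v h e -> spread v h e'.
Proof.
move=> h0 ee sp i i' s ii x y px py; apply: le_trans (sp _ _ _ ii _ _ px py).
by rewrite ler_pM2r.
Qed.

Lemma n_far_iff (R : realType) d n (delta : 'I_d.+1 -> 'rV[R]_d)
    (a : 'I_d.+1 -> nat -> 'I_d -> 'I_n) i : (2 <= n)%N ->
  n_far n (delta i) (omit delta i) <->
  exists2 e, 0 < e & forall m : nat,
    ((e * mesh R n m)%:E <= dist (walls (offsets delta a m i) (mesh R n m))
                                 (corners (offsets delta a m) (mesh R n m) i))%E.
Proof.
move=> n2; have B m k : boundaries (small_generation n (delta k) m) =
    walls (offsets delta a m k) (mesh R n m).
  exact: (boundaries_offset_cubes (delta k) m n2).
have E m : small_scale_lattice n (omit delta i) m =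
    corners (offsets delta a m) (mesh R n m) i.
  apply/seteqP; split=> x H k.
    by rewrite -B; exact: H.
  by move=> _; rewrite /omit B; exact: H.
by split=> -[e]; [case|]; move=> e0 H; exists e => //; [|split=> //] => m;
  have := H m; rewrite E B.
Qed.

Lemma boundaries_generation (R : realType) d n (delta : 'rV[R]_d)
    (L : nat -> 'rV[int]_d) m : (2 <= n)%N ->
  boundaries (generation n delta L m) = walls (offset delta L m) (mesh R n m).
Proof. exact: boundaries_offset_cubes. Qed.

Lemma corner_setE (R : realType) d n (delta : 'I_d.+1 -> 'rV[R]_d)
    (a : 'I_d.+1 -> nat -> 'I_d -> 'I_n) i j : (2 <= n)%N ->
  corner_set (delta i) (a i) j =
  walls (offsets delta a (- j%:Z) i) (mesh R n (- j%:Z))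
    `&` hcube 0 (mesh R n (- j%:Z)).
Proof.
by move=> n2; rewrite /corner_set boundaries_generation// /big_cube -mesh_neg.
Qed.

Lemma large_samplingE (R : realType) d n (delta : 'I_d.+1 -> 'rV[R]_d)
    (a : 'I_d.+1 -> nat -> 'I_d -> 'I_n) i j : (2 <= n)%N ->
  large_sampling (omit delta i) (omit a i) j =
  corners (offsets delta a (- j%:Z)) (mesh R n (- j%:Z)) i
    `&` hcube 0 (mesh R n (- j%:Z)).
Proof.
move=> n2; rewrite /large_sampling /big_cube -mesh_neg; congr (_ `&` _).
apply/seteqP; split=> x H k.
  by have := H k I; rewrite boundaries_generation.
by move=> _; rewrite boundaries_generation//; exact: H.
Qed.

Lemma sampling_nonempty (R : realType) d (v : 'I_d.+1 -> 'rV[R]_d) h i :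
  (1 <= d)%N -> 0 < h -> corners v h i `&` hcube 0 h !=set0.
Proof.
move=> d1 h0; pose s : 'I_d := Ordinal d1.
have [q pq qb] := progression_residue (v (lift i s) 0 s) h0.
have [Y [cY Ys Yb]] := corner_point h0 pq.
exists Y; split=> //; apply/hcube0P => u.
by have [->|/Yb//] := eqVneq u s; rewrite Ys.
Qed.

Lemma dist_ratio_le_dev_ratio (R : realType) d n (A S : nat -> set 'rV[R]_d) j :
  (1 <= d)%N -> (2 <= n)%N -> S j !=set0 ->
  (dist_ratio n A S j <= max_dev_ratio n A S j)%E.
Proof.
move=> d1 n2 [y Sy]; rewrite /dist_ratio /max_dev_ratio.
apply: lee_wpmul2r; first by rewrite lee_fin invr_ge0 exprn_ge0.
apply: (@le_trans _ _ (dev (A j) y)).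
  apply: le_trans (dist_le_dist_dir (Ordinal d1) _ Sy) _.
  exact: dist_dir_le_dev.
by apply: ereal_sup_ubound; exists y.
Qed.
Lemma spread_iff_ratios (R : realType) d n (delta : 'I_d.+1 -> 'rV[R]_d)
    (a : 'I_d.+1 -> nat -> 'I_d -> 'I_n) j (e : R) : (2 <= n)%N -> 0 < e ->
  spread (offsets delta a (- j%:Z)) (mesh R n (- j%:Z)) e <->
  forall i,
    let C := corner_set (delta i) (a i) in
    let S := large_sampling (omit delta i) (omit a i) in
    (e%:E <= dist_ratio n C S j)%E /\ (max_dev_ratio n C S j <= (1 - e)%:E)%E.
Proof.
move=> n2 e0; have h0 := mesh_gt0 R (- j%:Z) n2.
have N0 : 0 < (n%:R : R) ^+ j by rewrite -mesh_neg.
split=> [sp i C S|H].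
  have [lo up] := spread_box i h0 e0 sp.
  rewrite /dist_ratio /max_dev_ratio lee_pdivlMr// lee_pdivrMr//.
  rewrite /C /S corner_setE// large_samplingE// -mesh_neg; split=> //.
  by apply/ereal_supP => _ [y Sy <-]; exact: up.
apply: spread_of_box => // i; have := H i.
rewrite /dist_ratio /max_dev_ratio lee_pdivlMr// lee_pdivrMr//.
rewrite corner_setE// large_samplingE// -mesh_neg => -[lo /ereal_supP up].
by split=> // y Sy; apply: up; exists y.
Qed.

(** Strict bounds on the limits leave room for a common [e], valid for all grids
    from some [j] on. *)
Lemma spread_eventually (R : realType) d n (delta : 'I_d.+1 -> 'rV[R]_d)
    (a : 'I_d.+1 -> nat -> 'I_d -> 'I_n) : (2 <= n)%N ->
  (forall i : 'I_d.+1,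
     let C := corner_set (delta i) (a i) in
     let S := large_sampling (omit delta i) (omit a i) in
     (0 < limn_einf (dist_ratio n C S))%E /\
     (limn_esup (max_dev_ratio n C S) < 1)%E) ->
  exists2 e, 0 < e &
    \forall j \near \oo,
      spread (offsets delta a (- j%:Z)) (mesh R n (- j%:Z)) e.
Proof.
move=> n2 H.
pose P i (e : R) := \forall j \near \oo,
  let C := corner_set (delta i) (a i) in
  let S := large_sampling (omit delta i) (omit a i) in
  (e%:E <= dist_ratio n C S j)%E /\ (max_dev_ratio n C S j <= (1 - e)%:E)%E.
have Pmono i e e' : e' <= e -> P i e -> P i e'.
  move=> ee; apply: filterS => j [lo up]; split.
    by apply: le_trans lo; rewrite lee_fin.
  by apply: le_trans up _; rewrite lee_fin lerB.
have Pex i : exists2 e, 0 < e & P i e.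
  have [lo up] := H i.
  have [e1 e10 l1] := lt0e_gap lo; have [e2 e20 u2] := lte1_gap up.
  exists (Num.min e1 e2); first by rewrite lt_min e10.
  have := limn_esup_lt u2; apply: filterS2 (limn_einf_gt l1) => j lj uj; split.
    by apply: le_trans (ltW lj); rewrite lee_fin ge_min lexx.
  by apply: (le_trans (ltW uj)); rewrite lee_fin lerB// ge_min lexx orbT.
have [e e0 Pe] := uniform_positive Pmono Pex.
exists e => //; apply: filterS (filter_forall _ Pe) => j Pj.
exact/(spread_iff_ratios delta a j n2 e0).
Qed.

(** Coarse hyperplanes are fine hyperplanes, so the absolute distance does not
    decrease; only its ratio to the mesh is lost. *)
Lemma spread_coarser (R : realType) d n (delta : 'I_d.+1 -> 'rV[R]_d)
    (a : 'I_d.+1 -> nat -> 'I_d -> 'I_n) (m m' : int) (e : R) :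
  (2 <= n)%N -> m <= m' ->
  spread (offsets delta a m') (mesh R n m') e ->
  spread (offsets delta a m) (mesh R n m) (e * mesh R n m' / mesh R n m).
Proof.
move=> n2 mm' sp i i' s ii x y px py.
rewrite divfK ?gt_eqF ?mesh_gt0//.
exact: sp ii _ _ (progression_nested n2 mm' px) (progression_nested n2 mm' py).
Qed.

(** The finitely many generations that the second condition misses are coarser
    than generation [0], whose bound therefore covers them. *)
Lemma spread_iff_scales (R : realType) d n (delta : 'I_d.+1 -> 'rV[R]_d)
    (a : 'I_d.+1 -> nat -> 'I_d -> 'I_n) : (2 <= n)%N ->
  (exists2 e, 0 < e & forall m, spread (offsets delta a m) (mesh R n m) e) <->
  (exists2 e, 0 < e & forall m : nat, spread (offsets delta a m) (mesh R n m) e)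
  /\ (exists2 e, 0 < e & \forall j \near \oo,
        spread (offsets delta a (- j%:Z)) (mesh R n (- j%:Z)) e).
Proof.
move=> n2; split=> [[e e0 sp]|].
  by split; exists e => //; apply: nearW.
move=> [[e1 e10 sp1] [e2 e20 [N _ sp2]]].
have hN := mesh_gt0 R (- N%:Z) n2.
(* [mesh R n (- N%:Z)] exceeds the mesh of every generation left over. *)
pose e3 := e1 / mesh R n (- N%:Z); have e30 : 0 < e3 by rewrite divr_gt0.
exists (Num.min e1 (Num.min e2 e3)); first by rewrite !lt_min e10 e20.
have sle m e : spread (offsets delta a m) (mesh R n m) e ->
    Num.min e1 (Num.min e2 e3) <= e ->
    spread (offsets delta a m) (mesh R n m) (Num.min e1 (Num.min e2 e3)).
  by move=> sp le; apply: spread_le le sp; exact: mesh_gt0.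
case=> p; first by apply: sle (sp1 p) _; rewrite ge_min lexx.
have -> : Negz p = - p.+1%:Z by lia.
have [Np|pN] := leqP N p.+1.
  by apply: sle (sp2 _ Np) _; rewrite !ge_min lexx orbT.
have p0 : - p.+1%:Z <= 0%:Z by lia.
apply: sle (spread_coarser n2 p0 (sp1 0%N)) _.
have h0 := mesh_gt0 R (- p.+1%:Z) n2.
have -> : mesh R n 0 = 1 by rewrite /mesh expr0z invr1.
rewrite mulr1; apply: (@le_trans _ _ e3); first by rewrite !ge_min lexx !orbT.
by rewrite ler_pM2l// lef_pV2// ltW//; apply: mesh_lt => //; lia.
Qed.

Unset Implicit Arguments.
Set Strict Implicit.

Theorem theorem8p1 (R : realType) (d n : nat) (hd : (1 <= d)%N) (hn : (2 <= n)%N)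
    (delta : 'I_d.+1 -> 'rV[R]_d) (a : 'I_d.+1 -> nat -> 'I_d -> 'I_n)
    (hsep : separated_vectors delta) :
  adjacent_grids n (fun i => grid n (delta i) (location (a i))) <->
  (forall i : 'I_d.+1, n_far n (delta i) (omit delta i)) /\
  (forall i : 'I_d.+1,
     let C := corner_set (delta i) (a i) in
     let S := large_sampling (omit delta i) (omit a i) in
     [/\ (0 < limn_einf (dist_ratio n C S))%E,
         (limn_einf (dist_ratio n C S) <= limn_esup (max_dev_ratio n C S))%E
       & (limn_esup (max_dev_ratio n C S) < 1)%E]).
Proof.
apply: iff_trans (adjacent_iff_spread delta a hd hn) _.
split=> [[e e0 sp]|[far ratios]].
- split=> i.
    apply/(n_far_iff delta a i hn); exists e => // m.
    exact: ((spread_iff_dist _ (mesh_gt0 R m hn) e0).1 (sp m) i).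
  move=> C S.
  have b j := (spread_iff_ratios delta a j hn e0).1 (sp _) i.
  split.
  + apply: (@lt_le_trans _ _ e%:E); first by rewrite lte_fin.
    by apply: limn_einf_ge => j; exact: (b j).1.
  + apply: limn_einf_le_esup => j; apply: dist_ratio_le_dev_ratio => //.
    by rewrite /S large_samplingE//; apply: sampling_nonempty => //;
      exact: mesh_gt0.
  + apply: (@le_lt_trans _ _ (1 - e)%:E); last by rewrite lte_fin gtrBl.
    by apply: limn_esup_le => j; exact: (b j).2.
- apply/spread_iff_scales => //; split.
    pose P i e := forall m : nat,
      ((e * mesh R n m)%:E <= dist (walls (offsets delta a m i) (mesh R n m))
                                (corners (offsets delta a m) (mesh R n m) i))%E.
    have Pmono i e e' : e' <= e -> P i e -> P i e'.
      move=> ee Pe m; apply: le_trans (Pe m).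
      by rewrite lee_fin ler_wpM2r// ltW// mesh_gt0.
    have Pex i : exists2 e, 0 < e & P i e.
      exact: (n_far_iff delta a i hn).1 (far i).
    have [e e0 Pe] := uniform_positive Pmono Pex.
    exists e => // m.
    by apply/(spread_iff_dist _ (mesh_gt0 R m hn) e0) => i; exact: Pe.
  by apply: spread_eventually => // i; have [] := ratios i.
Qed.
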